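(* Let $p$ be a prime, let $0 \leq m \leq p-1$ and let $r, s \geq (m+1)(p+1)-1$ with $r \equiv s \bmod (p-1)$. If $p \nmid \binom{r}{m}$ and $p\nmid \binom{s}{m}$, then $$\frac{V_r}{V_r^{(m+1)}} \simeq \frac{V_s}{V_s^{(m+1)}}$$ as representations of $\mathrm{GL}_2(\mathbb{F}_p)$ over $\mathbb{F}_p$.
   Context: For $r\ge 0$, $V_r$ is the $r$-th symmetric power of the standard representation of $\mathrm{GL}_2(\mathbb{F}_p)$ over $\mathbb{F}_p$, identified with homogeneous polynomials $P(X,Y)$ of degree $r$ over $\mathbb{F}_p$, with action $\begin{pmatrix} a & b\\ c & d\end{pmatrix}\cdot P(X,Y)=P(aX+cY,bX+dY)$. Let $\theta=X^pY-XY^p$; $V_r^{(m+1)}$ is the subrepresentation of $V_r$ consisting of the polynomials divisible by $\theta^{m+1}$. *)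

(* Defs.v *)
From HB Require Import structures.
From mathcomp Require Import all_boot all_order all_algebra all_fingroup.
From mathcomp Require Import generic_quotient ring_quotient.
From mathcomp Require Import boolp.
From mathcomp Require Import mpoly.
From mathcomp Require Import ring.

Set Implicit Arguments.
Unset Strict Implicit.
Unset Printing Implicit Defensive.

Import GRing.Theory.
Local Open Scope ring_scope.
Local Open Scope quotient_scope.

Section QuotientModule.

Variables (F : fieldType) (V : lmodType F) (U : {pred V}).
Hypothesis U_closed : submod_closed U.

Definition submod_zmod : zmodClosed V :=
  HB.pack_for (zmodClosed V) (U : V -> bool)
    (GRing.isZmodClosed.Build V U (GRing.submod_closedB U_closed)).

Definition quot_mod : Type := Quotient.quot submod_zmod.

HB.instance Definition _ := GRing.Zmodule.on quot_mod.

Definition quot_proj (v : V) : quot_mod := \pi_(Quotient.quot submod_zmod) v.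
Definition quot_repr (x : quot_mod) : V :=
  repr (x : Quotient.quot submod_zmod).

Lemma quot_reprK : cancel quot_repr quot_proj.
Proof. by move=> x; exact: reprK. Qed.

Lemma quot_projP v w : quot_proj v = quot_proj w <-> v - w \in U.
Proof.
have -> : (v - w \in U) = (quot_proj v == quot_proj w).
  exact: (Quotient.idealrBE submod_zmod v w).
by split => /eqP.
Qed.

Definition quot_scale (a : F) (x : quot_mod) : quot_mod :=
  quot_proj (a *: quot_repr x).

Lemma quot_projZ a v : quot_scale a (quot_proj v) = quot_proj (a *: v).
Proof.
apply/quot_projP; rewrite -scalerBr.
have [U0 UZD] := U_closed; rewrite -[_ *: _]addr0; apply: UZD => //.
by apply/quot_projP; exact: quot_reprK.
Qed.

Lemma quot_projD v w : quot_proj (v + w) = quot_proj v + quot_proj w.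
Proof. exact: (raddfD (\pi_(Quotient.quot submod_zmod))). Qed.

Lemma quot_scaleA a b x : quot_scale a (quot_scale b x) = quot_scale (a * b) x.
Proof. by rewrite -[x]quot_reprK !quot_projZ scalerA. Qed.

Lemma quot_scale1 : left_id 1 quot_scale.
Proof. by move=> x; rewrite -[x]quot_reprK quot_projZ scale1r. Qed.

Lemma quot_scaleDr : right_distributive quot_scale +%R.
Proof.
move=> a x y; rewrite -[x]quot_reprK -[y]quot_reprK.
by rewrite -quot_projD !quot_projZ -quot_projD scalerDr.
Qed.

Lemma quot_scaleDl x : {morph quot_scale^~ x : a b / a + b}.
Proof.
by move=> a b; rewrite -[x]quot_reprK !quot_projZ -quot_projD scalerDl.
Qed.

HB.instance Definition _ := GRing.Zmodule_isLmodule.Build F quot_mod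
  quot_scaleA quot_scale1 quot_scaleDr quot_scaleDl.

Lemma quot_proj_linear : linear quot_proj.
Proof. by move=> a v w; rewrite quot_projD -quot_projZ. Qed.

HB.instance Definition _ :=
  GRing.isLinear.Build F V quot_mod _ quot_proj quot_proj_linear.

End QuotientModule.

Section Representations.

Variables (G : groupType) (F : fieldType).

Record representation := Representation {
  rep_space :> lmodType F;
  rep_act : G -> rep_space -> rep_space;
  rep_act_linear : forall g, linear (rep_act g);
  rep_act1 : forall v, rep_act 1%g v = v;
  rep_actM : forall g h v, rep_act (g * h)%g v = rep_act g (rep_act h v)
}.

Record subrepresentation (V : representation) := Subrepresentation {
  subrep_pred :> {pred V};
  subrep_closed : submod_closed subrep_pred;
  subrep_stable : forall g v, v \in subrep_pred -> rep_act g v \in subrep_pred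
}.

Definition rep_isomorphic (V W : representation) : Prop :=
  exists f : {linear V -> W},
    bijective f /\ forall g v, f (rep_act g v) = rep_act g (f v).

Section QuotientRepresentation.

Variables (V : representation) (U : subrepresentation V).

Let Q := quot_mod (subrep_closed U).
Let proj : V -> Q := quot_proj (subrep_closed U).

Definition quot_act (g : G) (x : Q) : Q := proj (rep_act g (quot_repr x)).

Lemma quot_act_proj g v : quot_act g (proj v) = proj (rep_act g v).
Proof.
apply/quot_projP.
have -> w : rep_act g w - rep_act g v = rep_act g (w - v).
  by rewrite addrC -scaleN1r -rep_act_linear scaleN1r addrC.
apply: subrep_stable; apply/(quot_projP (subrep_closed U)).
exact: quot_reprK.
Qed.

Lemma quot_act_linear g : linear (quot_act g).
Proof.
move=> a x y; rewrite -[x]quot_reprK -[y]quot_reprK -linearP !quot_act_proj.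
by rewrite rep_act_linear /proj linearP.
Qed.

Lemma quot_act1 x : quot_act 1%g x = x.
Proof. by rewrite -[x]quot_reprK quot_act_proj rep_act1. Qed.

Lemma quot_actM g h x : quot_act (g * h)%g x = quot_act g (quot_act h x).
Proof. by rewrite [LHS]/quot_act rep_actM -quot_act_proj. Qed.

Definition quot_rep : representation :=
  Representation quot_act_linear quot_act1 quot_actM.

End QuotientRepresentation.

End Representations.

Lemma comp_mpoly_comp (R : comNzRingType) (k l n : nat)
    (lq : n.-tuple {mpoly R[k]}) (lr : k.-tuple {mpoly R[l]}) P :
  (P \mPo lq) \mPo lr = P \mPo [tuple tnth lq j \mPo lr | j < n].
Proof.
rewrite (comp_mpolyEX P lq) (comp_mpolyEX P) raddf_sum.
apply: eq_bigr => u _; rewrite /= comp_mpolyZ; congr (_ *: _).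
rewrite !comp_mpolyX rmorph_prod; apply: eq_bigr => j _.
by rewrite /= rmorphXn tnth_mktuple.
Qed.

Lemma det_mx2 (R : comNzRingType) (A : 'M[R]_2) :
  \det A = A 0 0 * A 1 1 - A 0 1 * A 1 0.
Proof.
have l00 : lift (0 : 'I_2) 0 = 1 by apply: val_inj.
have l10 : lift (1 : 'I_2) 0 = 0 by apply: val_inj.
rewrite (expand_det_row _ 0) !big_ord_recl big_ord0 addr0 l00.
rewrite /cofactor !det_mx11 !mxE l00 l10 /= expr0 expr1 mul1r mulN1r.
by rewrite mulrN.
Qed.

Section SymmetricPowers.

Variable p : nat.

Local Notation GL2 := {'GL_2['F_p]}.
Local Notation X := ('X_(0 : 'I_2) : {mpoly 'F_p[2]}).
Local Notation Y := ('X_(1 : 'I_2) : {mpoly 'F_p[2]}).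

Definition GL2_subst (g : GL2) : 2.-tuple {mpoly 'F_p[2]} :=
  let a := GLval g 0 0 in let b := GLval g 0 1 in
  let c := GLval g 1 0 in let d := GLval g 1 1 in
  [tuple a *: X + c *: Y; b *: X + d *: Y].

Lemma GL2_substE g (j : 'I_2) :
  tnth (GL2_subst g) j = \sum_(i < 2) GLval g i j *: 'X_i.
Proof.
rewrite big_ord_recl big_ord1 (tnth_nth 0).
have -> : lift ord0 ord0 = 1 :> 'I_2 by apply: val_inj.
have [->|->] // : j = 0 \/ j = 1.
by case: j => [[|[|[]]] // lt_j2]; [left|right]; apply: val_inj.
Qed.

Lemma GL2_subst_homog g (j : 'I_2) : tnth (GL2_subst g) j \is 1.-homog.
Proof.
rewrite GL2_substE rpred_sum // => i _.
by rewrite rpredZ // dhomogX /= mdeg1.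
Qed.

Lemma GL2_act_homog r g (P : dhomog 2 'F_p r) :
  val P \mPo GL2_subst g \is r.-homog.
Proof.
rewrite comp_mpolyEX big_seq rpred_sum // => u Pu; rewrite rpredZ //.
have <- : mdeg u = r by apply: (dhomogP _ _ _ (valP P)).
rewrite comp_mpolyX mdegE.
elim/big_ind2: _ => [|d1 P1 d2 P2|i _]; first exact: dhomog1.
  exact: dhomogM.
by have := dhomogMn (u i) (GL2_subst_homog g i); rewrite mul1n.
Qed.

Definition GL2_act r (g : GL2) (P : dhomog 2 'F_p r) : dhomog 2 'F_p r :=
  DHomog (GL2_act_homog g P).

Lemma GL2_act_linear r g : linear (@GL2_act r g).
Proof. by move=> a P Q; apply: val_inj; rewrite /= linearP. Qed.

Lemma GL2_act1 r (P : dhomog 2 'F_p r) : GL2_act 1%g P = P.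
Proof.
apply: val_inj; rewrite /=.
suff -> : GL2_subst 1%g = [tuple 'X_i | i < 2] by rewrite comp_mpoly_id.
apply: eq_from_tnth => j; rewrite GL2_substE tnth_mktuple.
rewrite GL_1E (bigD1 j) //= mxE eqxx scale1r big1 ?addr0 // => i /negPf nij.
by rewrite mxE nij scale0r.
Qed.

Lemma GL2_actM r g h (P : dhomog 2 'F_p r) :
  GL2_act (g * h)%g P = GL2_act g (GL2_act h P).
Proof.
apply: val_inj; rewrite /= comp_mpoly_comp.
suff -> : GL2_subst (g * h)%g =
  [tuple tnth (GL2_subst h) j \mPo GL2_subst g | j < 2] by [].
apply: eq_from_tnth => j; rewrite tnth_mktuple !GL2_substE raddf_sum GL_MxE.
under eq_bigr => i _ do rewrite mxE scaler_suml.
rewrite exchange_big; apply: eq_bigr => k _ /=.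
rewrite comp_mpolyZ comp_mpolyXU -tnth_nth GL2_substE scaler_sumr.
by apply: eq_bigr => i _; rewrite scalerA mulrC.
Qed.

Definition sym_rep (r : nat) : representation GL2 'F_p :=
  Representation (@GL2_act_linear r) (@GL2_act1 r) (@GL2_actM r).

Definition theta : {mpoly 'F_p[2]} := X ^+ p * Y - X * Y ^+ p.

Definition theta_multiple (r k : nat) : {pred sym_rep r} :=
  fun P => `[< exists Q : {mpoly 'F_p[2]}, mpoly_of_dhomog P = theta ^+ k * Q >].

Arguments theta_multiple : clear implicits.

Lemma theta_multiple_closed r k : submod_closed (theta_multiple r k).
Proof.
split=> [|a P1 P2 /asboolP[Q1 E1] /asboolP[Q2 E2]]; apply/asboolP.
  by exists 0; rewrite mulr0.
by exists (a *: Q1 + Q2); rewrite /= E1 E2 mulrDr scalerAr.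
Qed.

(* For composite p, 'F_p is the field with [pdiv p] elements, and [theta] is
   not a GL_2-eigenvector. *)
Hypothesis p_pr : prime p.

Lemma Fp_expp (a : 'F_p) : a ^+ p = a.
Proof.
by rewrite -(pFrobenius_autE (pchar_Fp p_pr)) -[a]natr_Zp pFrobenius_aut_nat.
Qed.

Lemma expp_lin (a b : 'F_p) (P Q : {mpoly 'F_p[2]}) :
  (a *: P + b *: Q) ^+ p = a *: P ^+ p + b *: Q ^+ p.
Proof.
have pchar_mpoly : p \in [pchar {mpoly 'F_p[2]}].
  by rewrite pchar_lalg pchar_Fp.
rewrite exprDn_pchar; last by rewrite pnatE.
by rewrite !exprZn !Fp_expp.
Qed.

Lemma theta_subst (g : GL2) :
  theta \mPo GL2_subst g = \det (GLval g) *: theta.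
Proof.
rewrite /theta rmorphB !rmorphM !rmorphXn /= !comp_mpolyXU /= !expp_lin.
rewrite det_mx2 -!mul_mpolyC !rmorphB !rmorphM /=.
ring.
Qed.

Lemma theta_multiple_stable r k g (P : sym_rep r) :
  P \in theta_multiple r k -> rep_act g P \in theta_multiple r k.
Proof.
move=> /asboolP[Q E]; apply/asboolP.
exists (\det (GLval g) ^+ k *: (Q \mPo GL2_subst g)).
rewrite /= E rmorphM rmorphXn /= theta_subst exprZn.
by rewrite -scalerAl scalerAr.
Qed.

Definition theta_subrep (r k : nat) : subrepresentation (sym_rep r) :=
  Subrepresentation (theta_multiple_closed r k) (@theta_multiple_stable r k).

End SymmetricPowers.

(* Main.v *)
From HB Require Import structures.
Require Import Defs.
From mathcomp Require Import all_boot all_algebra all_fingroup finfield.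
From mathcomp Require Import boolp mpoly ring zify.

(** Write the elements of V_r in the affine coordinate t, as P(1, t): the
    coefficient of t^i is that of X^(r-i) Y^i, so the first m+1 coefficients are
    the m-jet of P at the point (1, 0) of the projective line over F_p, where
    Y = 0. The first m+1 coefficients of g.P likewise describe the m-jet of P
    at the point (a, b) given by the first row of g.

    Since theta is, up to a scalar, the product of one linear form for each
    of the p+1 points, P lies in V_r^(m+1) exactly when all its m-jets vanish
    ([theta_multiple_jet]). As r is at least (m+1)(p+1)-1, the jets at the
    p+1 points can moreover be prescribed independently
    ([interpolation_block], [prescribed_at_representatives]). So the quotient
    is the representation induced from the Borel subgroup B fixing the point
    Y = 0, acting on the m-jets there, and it remains to compare these
    (m+1)-dimensional representations of B for r and s.

    The torus of B acts on X^(r-i) Y^i through a^(r-i) d^i, which depends on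
    r modulo p-1 only. Its unipotent part is governed by the operator sending
    X^(r-i) Y^i to (r-i) X^(r-i-1) Y^(i+1); since m < p and p does not divide
    C(r, m), the factors r, r-1, .., r-m+1 are invertible, and rescaling the
    i-th basis vector by C(s, i) / C(r, i) turns the operator for r into the
    one for s. Hence the condition
      C(r, i) jet_i Q = C(s, i) jet_i P    for all i <= m
    is B-invariant ([jets_match_borel]).

    Imposing this condition on g.P and g.Q for every g defines a G-invariant
    linear relation between V_r and V_s. It is total on both sides
    ([jets_match_total]) and matches the two subspaces
    ([theta_multiple_transfer]), so it induces the isomorphism
    ([quot_rep_isomorphic_of_correspondence]). *)

Set Implicit Arguments.
Unset Strict Implicit.
Unset Printing Implicit Defensive.

Import GRing.Theory.
Local Open Scope ring_scope.

(** * Isomorphisms of quotients from correspondences *)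

(** A relation replaces the map V -> W that would induce the isomorphism: a
    relation can be symmetric in V and W and visibly G-invariant, whereas the
    natural lifts of the isomorphism to V involve a choice of coset
    representatives. The third hypothesis, with linearity, makes the relation
    descend to the graph of an injective map. *)
Lemma quot_rep_isomorphic_of_correspondence (G : groupType) (F : fieldType)
    (V W : representation G F) (A : subrepresentation V)
    (B : subrepresentation W) (R : V -> W -> Prop) :
  (forall a v1 w1 v2 w2, R v1 w1 -> R v2 w2 ->
     R (a *: v1 + v2) (a *: w1 + w2)) ->
  (forall g v w, R v w -> R (rep_act g v) (rep_act g w)) ->
  (forall v w, R v w -> v \in A <-> w \in B) ->
  (forall v, exists w, R v w) -> (forall w, exists v, R v w) ->
  rep_isomorphic (quot_rep A) (quot_rep B).
Proof.
move=> Rlin Ract RAB /choice[f Rf] /choice[h Rh].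
pose prA := quot_proj (subrep_closed A).
pose prB := quot_proj (subrep_closed B).
have RP v1 w1 v2 w2 : R v1 w1 -> R v2 w2 -> prA v1 = prA v2 <-> prB w1 = prB w2.
  move=> R1 R2; have := RAB _ _ (Rlin (-1) _ _ _ _ R2 R1).
  by rewrite !scaleN1r ![- _ + _]addrC /prA /prB !quot_projP.
pose phi (x : quot_rep A) : quot_rep B := prB (f (quot_repr x)).
have phiP v w : R v w -> phi (prA v) = prB w.
  by move=> Rvw; apply/(RP _ _ _ _ (Rf _) Rvw)/quot_reprK.
have phi_lin : linear phi.
  move=> a x y; rewrite -[x]quot_reprK -[y]quot_reprK -linearP.
  rewrite (phiP _ _ (Rlin a _ _ _ _ (Rf _) (Rf _))).
  by rewrite /prB linearP -/prB !(phiP _ _ (Rf _)).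
pose phiL : {linear quot_rep A -> quot_rep B} :=
  HB.pack phi (GRing.isLinear.Build F _ _ _ phi phi_lin).
exists phiL; split; last first.
  move=> g x; rewrite -[x in LHS]quot_reprK /=.
  rewrite quot_act_proj (phiP _ _ (Ract g _ _ (Rf _))).
  by rewrite quot_act_proj.
exists (fun y => prA (h (quot_repr y))) => [x|y].
  rewrite /= -[RHS](quot_reprK (U_closed := subrep_closed A)).
  apply/(RP _ _ _ _ (Rh _) (Rf _)).
  exact: quot_reprK.
by rewrite /= (phiP _ _ (Rh _)); exact: quot_reprK.
Qed.

(** * Binary forms in the affine coordinate *)

Lemma poly_widen (F : fieldType) n (q : {poly F}) :
  (size q <= n)%N -> q = \sum_(j < n) q`_j *: 'X^j.
Proof. by move=> qn; rewrite -poly_def -/(take_poly n q) take_poly_id. Qed.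

Section BinaryForms.

Variable F : fieldType.

(* This is P(1, t): the powers 'X^0 and 'X^1 are the images of the variables of
   indices 0 and 1. *)
Local Notation dehomog := (mmap (@polyC F) (fun i : 'I_2 => 'X^i)).
Local Notation X := ('X_(0 : 'I_2) : {mpoly F[2]}).
Local Notation Y := ('X_(1 : 'I_2) : {mpoly F[2]}).

Lemma dehomogX : dehomog X = 1.
Proof. by rewrite mmapX mmap1U. Qed.

Lemma dehomogY : dehomog Y = 'X.
Proof. by rewrite mmapX mmap1U. Qed.

Lemma homog_varX (i : 'I_2) k : ('X_i : {mpoly F[2]}) ^+ k \is k.-homog.
Proof.
have Xi_homog : ('X_i : {mpoly F[2]}) \is 1.-homog by rewrite dhomogX /= mdeg1.
by have := dhomogMn k Xi_homog; rewrite mul1n.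
Qed.

Definition homogenize (r : nat) (q : {poly F}) : {mpoly F[2]} :=
  \sum_(j < r.+1) q`_j *: (X ^+ (r - j) * Y ^+ j).

Lemma homogenize_homog (r : nat) (q : {poly F}) : homogenize r q \is r.-homog.
Proof.
rewrite rpred_sum // => j _; rewrite rpredZ //.
have := dhomogM (homog_varX 0 (r - j)%N) (homog_varX 1 j).
by rewrite subnK // -ltnS.
Qed.

Lemma homogenizeK (r : nat) (q : {poly F}) :
  (size q <= r.+1)%N -> dehomog (homogenize r q) = q.
Proof.
move=> qr; rewrite raddf_sum /= [RHS](poly_widen qr); apply: eq_bigr => j _.
by rewrite mmapZ mul_polyC rmorphM !rmorphXn /= dehomogX dehomogY expr1n mul1r.
Qed.

Lemma dehomogK r (P : {mpoly F[2]}) :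
  P \is r.-homog -> homogenize r (dehomog P) = P.
Proof.
move=> /dhomogP Ph; rewrite {1}(mpolyE P) raddf_sum /=.
transitivity (\sum_(u <- msupp P) P@_u *: homogenize r (dehomog 'X_[u])).
  transitivity (\sum_(u <- msupp P) \sum_(j < r.+1)
      P@_u *: ((dehomog 'X_[u])`_j *: (X ^+ (r - j) * Y ^+ j))); last first.
    by apply: eq_bigr => u _; rewrite scaler_sumr.
  rewrite exchange_big; apply: eq_bigr => j _ /=.
  rewrite coef_sum scaler_suml; apply: eq_bigr => u _.
  by rewrite mmapZ coefCM scalerA.
rewrite [RHS](mpolyE P); apply: eq_big_seq => u Pu.
have i1 : lift ord0 ord0 = 1 :> 'I_2 by apply: val_inj.
have du : mdeg u = r by exact: Ph.
rewrite mdegE big_ord_recl big_ord1 i1 in du.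
have lu : (u 1%R < r.+1)%N by rewrite -du ltnS leq_addl.
congr (_ *: _); rewrite /homogenize (bigD1 (Ordinal lu)) //=.
rewrite big1 => [|j]; last first.
  rewrite -val_eqE /= mmapX /mmap1 big_ord_recl big_ord1 i1 expr1n mul1r expr1.
  by rewrite coefXn => /negPf->; rewrite scale0r.
rewrite mmapX /mmap1 big_ord_recl big_ord1 i1 expr1n mul1r expr1.
rewrite coefXn eqxx scale1r addr0 -du addnK.
by rewrite [RHS]mpolyXE_id big_ord_recl big_ord1 i1.
Qed.

Lemma dehomog_inj r (P Q : {mpoly F[2]}) :
  P \is r.-homog -> Q \is r.-homog -> dehomog P = dehomog Q -> P = Q.
Proof. by move=> /dehomogK EP /dehomogK EQ E; rewrite -EP -EQ E. Qed.

Lemma dehomog_subst r (P : {mpoly F[2]}) (lq : 2.-tuple {mpoly F[2]}) :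
    P \is r.-homog ->
  dehomog (P \mPo lq) = \sum_(j < r.+1) (dehomog P)`_j *:
    (dehomog (tnth lq 0) ^+ (r - j) * dehomog (tnth lq 1) ^+ j).
Proof.
move=> /dehomogK EP; rewrite -{1}EP (raddf_sum (comp_mpoly lq)) raddf_sum.
apply: eq_bigr => j _ /=.
rewrite comp_mpolyZ mmapZ mul_polyC rmorphM !rmorphXn /= !comp_mpolyXU.
by rewrite rmorphM !rmorphXn -!tnth_nth.
Qed.

Lemma size_dehomog r (P : {mpoly F[2]}) :
  P \is r.-homog -> (size (dehomog P) <= r.+1)%N.
Proof.
move=> /dehomogK EP; rewrite -EP raddf_sum.
apply: (leq_trans (size_sum _ _ _)); apply/bigmax_leqP => j _ /=.
rewrite mmapZ mul_polyC rmorphM !rmorphXn /= dehomogX dehomogY expr1n mul1r.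
by rewrite (leq_trans (size_scale_leq _ _)) // size_polyXn.
Qed.

End BinaryForms.

Local Notation dehomog := (mmap (@polyC _) (fun i : 'I_2 => 'X^i)).

Lemma GL2_of_det p (A : 'M['F_p]_2) :
  \det A != 0 -> exists g : {'GL_2['F_p]}, GLval g = A.
Proof.
rewrite -unitfE -unitmxE => A_unit.
by exists (FinRing.unit _ A_unit).
Qed.

Lemma dehomog_GL2_subst p (g : {'GL_2['F_p]}) (j : 'I_2) :
  dehomog (tnth (GL2_subst g) j) = (GLval g 0 j)%:P + GLval g 1 j *: 'X.
Proof.
rewrite GL2_substE big_ord_recl big_ord1 mmapD !mmapZ !mul_polyC.
have -> : lift ord0 ord0 = 1 :> 'I_2 by apply: val_inj.
by rewrite dehomogX dehomogY alg_polyC.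
Qed.

Section Jets.

Variables (p r : nat).
Implicit Types (P : sym_rep p r) (g : {'GL_2['F_p]}).

Definition affine P : {poly 'F_p} := dehomog (mpoly_of_dhomog P).

Lemma affine_is_linear : linear affine.
Proof. by move=> a P Q; rewrite /affine /= mmapD mmapZ mul_polyC. Qed.

HB.instance Definition _ :=
  GRing.isLinear.Build _ _ _ _ affine affine_is_linear.

Lemma homog_sym_rep P : mpoly_of_dhomog P \is r.-homog.
Proof. exact: valP P. Qed.

Lemma affine_act g P :
  affine (rep_act g P) = \sum_(j < r.+1) (affine P)`_j *:
    (((GLval g 0 0)%:P + GLval g 1 0 *: 'X) ^+ (r - j) *
     ((GLval g 0 1)%:P + GLval g 1 1 *: 'X) ^+ j).
Proof.
by rewrite /affine (dehomog_subst _ (homog_sym_rep P)) !dehomog_GL2_subst.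
Qed.

End Jets.

(** * Multiples of powers of theta and vanishing jets *)

Lemma dvdp_Xn_coef (F : fieldType) (f : {poly F}) k :
  (forall i, (i < k)%N -> f`_i = 0) -> 'X^k %| f.
Proof.
move=> f0; rewrite -[f](poly_take_drop k) [take_poly _ _](_ : _ = 0).
  by rewrite add0r dvdp_mull.
by apply/polyP => i; rewrite coef_take_poly coef0; case: ifP => // /f0.
Qed.

Lemma dvdp_prod_XsubC_exp (F : fieldType) (f : {poly F}) (s : seq F) k :
  uniq s -> (forall z, z \in s -> ('X - z%:P) ^+ k %| f) ->
  \prod_(z <- s) ('X - z%:P) ^+ k %| f.
Proof.
elim: s => [_ _|z s IHs /= /andP[zs us] sf]; first by rewrite big_nil dvd1p.
rewrite big_cons Gauss_dvdp ?sf ?mem_head //.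
  by apply: IHs => // y ys; apply: sf; rewrite inE ys orbT.
rewrite coprimep_expl // coprimep_sym coprimep_XsubC /root horner_prod.
rewrite prodf_seq_neq0; apply/allP => y ys /=.
rewrite horner_exp !hornerE expf_neq0 // subr_eq0.
by apply: contraNneq zs => ->.
Qed.

Lemma size_mul_XnsubX_exp (F : fieldType) (q : {poly F}) n k :
    (1 < n)%N -> q != 0 ->
  size (q * ('X^n - 'X) ^+ k) = (size q + k * n)%N.
Proof.
move=> n_gt1 q_neq0; have size_base : size ('X^n - 'X : {poly F}) = n.+1.
  by rewrite size_polyDl ?size_polyXn // size_polyN size_polyX ltnS.
have base_neq0 : 'X^n - 'X != 0 :> {poly F} by rewrite -size_poly_eq0 size_base.
elim: k => [|k IHk]; first by rewrite expr0 mulr1 addn0.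
rewrite exprSr mulrA size_mul ?mulf_neq0 ?expf_neq0 // IHk size_base.
by rewrite addnS /= mulSn -addnA [(n + _)%N]addnC.
Qed.

Lemma theta_homog p : theta p \is p.+1.-homog.
Proof.
rewrite rpredB //.
  by have := dhomogM (homog_varX 'F_p 0 p) (homog_varX 'F_p 1 1); rewrite addn1.
by have := dhomogM (homog_varX 'F_p 0 1) (homog_varX 'F_p 1 p).
Qed.

Lemma dehomog_theta p : dehomog (theta p) = 'X - 'X^p.
Proof.
rewrite rmorphB !rmorphM !rmorphXn /=.
by rewrite dehomogX dehomogY expr1n !mul1r.
Qed.

(** A multiple of theta^k has vanishing jets because theta is a semi-invariant
    vanishing at Y = 0. Conversely, the translations X -> X, Y -> zX + Y yield
    the zeros of order k at the affine points, hence (t^p - t)^k | P(1, t); the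
    exchange of X and Y bounds the degree of P(1, t) by r - k, which leaves
    room for the zero of order k at infinity. *)
Lemma theta_multiple_jet p r k (p_pr : prime p) (P : sym_rep p r) :
  P \in theta_subrep p_pr r k <->
  forall g i, (i < k)%N -> (affine (rep_act g P))`_i = 0.
Proof.
split=> [/theta_multiple_stable stab g i ik|jet0].
  have /asboolP[Q E] := stab p_pr g.
  rewrite /affine E rmorphM rmorphXn /= dehomog_theta.
  have -> : 'X - 'X^p = 'X * (1 - 'X^(p.-1)) :> {poly 'F_p}.
    by rewrite mulrBr mulr1 -exprS prednK ?prime_gt0.
  by rewrite exprMn -mulrA coefXnM ik.
apply/asboolP.
have [P0|P_neq0] := eqVneq (affine P) 0.
  exists 0; rewrite mulr0; apply: (dehomog_inj (homog_sym_rep P)).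
    exact: rpred0.
  by rewrite -/(affine P) P0 raddf0.
have Psize : (size (affine P) <= r.+1)%N by apply/size_dehomog/homog_sym_rep.
have Xp_dvd : ('X^p - 'X) ^+ k %| affine P.
  have -> : 'X^p - 'X = \prod_(z : 'F_p) ('X - z%:P).
    by rewrite -finField_genPoly card_Fp.
  rewrite -prodrXl -big_enum.
  apply: dvdp_prod_XsubC_exp => [|z _]; first exact: enum_uniq.
  have [|g gE] := @GL2_of_det p
      (\matrix_(i, j) if i == j then 1 else if i == 0 then z else 0).
    by rewrite det_mx2 !mxE /= mulr0 subr0 mulr1 oner_neq0.
  have : 'X^k %| affine (rep_act g P).
    by apply: dvdp_Xn_coef => i; apply: jet0.
  have -> : affine (rep_act g P) = affine P \Po ('X + z%:P).
    rewrite affine_act gE !mxE /= {2}(poly_widen Psize) raddf_sum.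
    apply: eq_bigr => j _ /=; rewrite comp_polyZ comp_Xn_poly.
    by rewrite scale0r addr0 expr1n mul1r scale1r addrC.
  move=> /(dvdp_comp_poly ('X - z%:P)).
  rewrite -comp_polyA comp_polyD comp_polyX comp_polyC subrK comp_polyXr.
  by rewrite comp_Xn_poly.
have top0 i : (i < k)%N -> (i <= r)%N -> (affine P)`_(r - i) = 0.
  move=> ik ir.
  have [|g gE] := @GL2_of_det p (\matrix_(i, j) if i == j then 0 else 1).
    by rewrite det_mx2 !mxE /= mul0r sub0r mulr1 oppr_eq0 oner_neq0.
  have := jet0 g i ik; rewrite affine_act gE !mxE /= coef_sum.
  have lt_ir : (r - i < r.+1)%N by rewrite ltnS leq_subr.
  rewrite (bigD1 (Ordinal lt_ir)) //= big1 => [|j].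
    rewrite addr0 polyC0 polyC1 add0r !scale1r scale0r addr0 expr1n mulr1.
    by rewrite subKn // coefZ coefXn eqxx mulr1 => ->.
  rewrite -val_eqE /= polyC0 polyC1 add0r !scale1r scale0r addr0 expr1n mulr1.
  rewrite coefZ coefXn => j_neq; case: eqP => [ij|]; last by rewrite mulr0.
  by move: j_neq; rewrite ij subKn ?eqxx // -ltnS.
have {top0} degP : (size (affine P) + k <= r.+1)%N.
  rewrite leqNgt; apply: contra_neqN P_neq0 => deg_gt.
  have [Psize0|Psize_gt0] := posnP (size (affine P)).
    by apply/eqP; rewrite -size_poly_eq0 Psize0.
  apply/eqP; rewrite -lead_coef_eq0 /lead_coef; apply/eqP.
  have -> : ((size (affine P)).-1 = r - (r - (size (affine P)).-1))%N by lia.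
  by apply: top0; lia.
have [q qE] := dvdpP _ _ Xp_dvd.
have q_neq0 : q != 0 by apply: contra_neq P_neq0 => q0; rewrite qE q0 mul0r.
have sizeq : (size q + k * p.+1 <= r.+1)%N.
  move: degP; rewrite qE size_mul_XnsubX_exp ?prime_gt1 // mulnS.
  by rewrite -addnA [(k * p + k)%N]addnC.
have q_gt0 : (0 < size q)%N by rewrite size_poly_gt0.
exists (homogenize (r - k * p.+1) ((-1) ^+ k *: q)).
apply: (dehomog_inj (homog_sym_rep P)).
  have := dhomogM (dhomogMn k (theta_homog p))
    (homogenize_homog (r - k * p.+1) ((-1) ^+ k *: q)).
  by rewrite mulnC subnKC //; lia.
rewrite -/(affine P) qE rmorphM rmorphXn /= dehomog_theta.
rewrite homogenizeK; last first.
  by rewrite (leq_trans (size_scale_leq _ _)) //; lia.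
have -> : 'X^p - 'X = -1 * ('X - 'X^p) :> {poly 'F_p} by rewrite mulN1r opprB.
rewrite exprMn mulrCA [q * _]mulrC -scalerAr -mul_polyC.
by rewrite polyC_exp polyCN polyC1.
Qed.

(** * Borel invariance of the matching of jets *)

Lemma bin_mul_bin n i j : (j <= i)%N -> (i <= n)%N ->
  ('C(n, j) * 'C(n - j, i - j) = 'C(n, i) * 'C(i, j))%N.
Proof.
move=> ji i_n; have jn := leq_trans ji i_n.
have fact_pos : (0 < j`! * (i - j)`! * (n - i)`!)%N.
  by rewrite !muln_gt0 !fact_gt0.
apply/eqP; rewrite -(eqn_pmul2r fact_pos); apply/eqP.
transitivity n`!.
  rewrite -(bin_fact jn) -(@bin_fact (n - j) (i - j)) ?leq_sub2r //.
  by rewrite subnBA // subnK //; ring.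
by rewrite -(bin_fact i_n) -(bin_fact ji); ring.
Qed.

Lemma prime_dvd_fact p n : prime p -> (p %| n`!)%N = (p <= n)%N.
Proof.
move=> p_pr; elim: n => [|n IHn].
  by rewrite fact0 dvdn1 leqn0; case: p p_pr => [|[]].
rewrite factS Euclid_dvdM // IHn; apply/orP/idP => [[/dvdn_leq->|/leqW]//|].
by rewrite leq_eqVlt ltnS => /predU1P[->|->]; [left|right].
Qed.

(** C(n, j) divides C(n, m) C(m, j), and C(m, j) divides m!, which is prime
    to p. *)
Lemma bin_ndvd_le p n m j : prime p -> (m < p)%N -> (j <= m)%N ->
  ~~ (p %| 'C(n, m))%N -> ~~ (p %| 'C(n, j))%N.
Proof.
move=> p_pr mp jm p_ndvd.
have mn : (m <= n)%N by rewrite -bin_gt0 lt0n; apply: contraNneq p_ndvd => ->.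
have : ~~ (p %| 'C(n, m) * 'C(m, j))%N.
  rewrite Euclid_dvdM // negb_or p_ndvd /=.
  apply: contraL mp => p_dvd; rewrite -leqNgt -prime_dvd_fact //.
  by rewrite -(bin_fact jm) dvdn_mulr.
by rewrite -bin_mul_bin //; apply: contraNN => /dvdn_mulr->.
Qed.

Lemma Fp_natr_neq0 p n : prime p -> (n%:R != 0 :> 'F_p) = ~~ (p %| n)%N.
Proof. by move=> p_pr; rewrite (dvdn_pcharf (pchar_Fp p_pr)). Qed.

Lemma coef_affine_exp (R : comNzRingType) (a c : R) n k :
  ((a%:P + c *: 'X) ^+ n)`_k = a ^+ (n - k) * c ^+ k *+ 'C(n, k).
Proof.
rewrite exprDn coef_sum.
have term i : ((a%:P ^+ (n - i) * (c *: 'X) ^+ i) *+ 'C(n, i))`_k =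
    if i == k then a ^+ (n - k) * c ^+ k *+ 'C(n, k) else 0.
  rewrite exprZn -scalerAr -polyC_exp mul_polyC coefMn !coefZ coefXn.
  rewrite eq_sym; case: eqP => [->|_]; last by rewrite !mulr0 mul0rn.
  by rewrite mulr1 mulrC.
under eq_bigr => i _ do rewrite term.
rewrite -big_mkcond /=.
have [kn|nk] := ltnP k n.+1.
  by rewrite (big_pred1 (Ordinal kn)).
rewrite bin_small // mulr0n big_pred0 // => i.
by apply/negbTE; rewrite neq_ltn (leq_trans (ltn_ord i)).
Qed.

(** An element of the Borel subgroup maps Y to dY, so the i-th coefficient of
    b.P involves the coefficients of P of index at most i only: b acts on the
    jets at Y = 0. *)
Lemma coef_affine_borel p r (P : sym_rep p r) (b : {'GL_2['F_p]}) i :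
    GLval b 0 1 = 0 -> (i <= r)%N ->
  (affine (rep_act b P))`_i = \sum_(j < i.+1)
    (affine P)`_j * (GLval b 0 0 ^+ (r - i) * GLval b 1 0 ^+ (i - j) *
      GLval b 1 1 ^+ j *+ 'C(r - j, i - j)).
Proof.
move=> b01 ir; rewrite affine_act b01 coef_sum.
rewrite [RHS](big_ord_widen r.+1 (fun j => (affine P)`_j *
  (GLval b 0 0 ^+ (r - i) * GLval b 1 0 ^+ (i - j) *
    GLval b 1 1 ^+ j *+ 'C(r - j, i - j)))) //.
rewrite [RHS]big_mkcond; apply: eq_bigr => j _.
rewrite polyC0 add0r exprZn -scalerAr !coefZ coefMXn ltnS.
case: leqP => [ji|_]; last by rewrite !mulr0.
rewrite coef_affine_exp -subnDA subnKC // mulrnAr; congr (_ * (_ *+ _)).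
by rewrite mulrC.
Qed.

Lemma Fp_expr_pred p (a : 'F_p) : prime p -> a != 0 -> a ^+ (p - 1) = 1.
Proof.
move=> p_pr a_neq0; apply: (mulfI a_neq0).
by rewrite mulr1 -exprS subn1 prednK ?prime_gt0 // Fp_expp.
Qed.

Lemma Fp_expr_modn p (a : 'F_p) r s : prime p -> a != 0 ->
  r = s %[mod p - 1] -> a ^+ r = a ^+ s.
Proof.
move=> p_pr a_neq0 rs; have a_pred := Fp_expr_pred p_pr a_neq0.
by rewrite -(expr_mod r a_pred) rs expr_mod.
Qed.

(** Cross-multiplied form of the condition that the rescaling of the i-th
    coefficient by C(s, i) / C(r, i) carry the m-jet of P at Y = 0 to that of
    Q; this form is visibly symmetric in P and Q. *)
Definition jets_match m p r s (P : sym_rep p r) (Q : sym_rep p s) :=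
  forall i, (i <= m)%N ->
    'C(r, i)%:R * (affine Q)`_i = 'C(s, i)%:R * (affine P)`_i.

Lemma jets_match_linear m p r s a (P1 P2 : sym_rep p r) (Q1 Q2 : sym_rep p s) :
  jets_match m P1 Q1 -> jets_match m P2 Q2 ->
  jets_match m (a *: P1 + P2) (a *: Q1 + Q2).
Proof.
move=> PQ1 PQ2 i im.
have lin n (U V : sym_rep p n) :
    (affine (a *: U + V))`_i = a * (affine U)`_i + (affine V)`_i.
  by rewrite affine_is_linear coefD coefZ.
rewrite [X in _ * X = _]lin [X in _ = _ * X]lin !mulrDr.
rewrite mulrCA [in RHS]mulrCA.
exact: (congr2 (fun x y => a * x + y) (PQ1 i im) (PQ2 i im)).
Qed.

Lemma jets_match_sym m p r s (P : sym_rep p r) (Q : sym_rep p s) :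
  jets_match m P Q -> jets_match m Q P.
Proof. by move=> PQ i im; apply/esym/PQ. Qed.

(** The rescaling intertwines the two actions of B because
    C(n, j) C(n-j, i-j) = C(n, i) C(i, j): after multiplication by C(r, j), the
    j-th terms on both sides become C(r, i) C(s, i) C(i, j) times the same
    quantity. *)
Lemma jets_match_borel m p r s (P : sym_rep p r) (Q : sym_rep p s)
    (b : {'GL_2['F_p]}) :
    prime p -> (m < p)%N -> (m <= r)%N -> (m <= s)%N ->
    r = s %[mod p - 1] -> ~~ (p %| 'C(r, m))%N ->
    GLval b 0 1 = 0 ->
  jets_match m P Q -> jets_match m (rep_act b P) (rep_act b Q).
Proof.
move=> p_pr mp mr ms rs r_ndvd b01 PQ i im.
have [ir i_s] := (leq_trans im mr, leq_trans im ms).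
have a_neq0 : GLval b 0 0 != 0.
  apply: contraNneq (GL_det b) => b00.
  by rewrite det_mx2 b00 b01 !mul0r subrr.
have Ea : GLval b 0 0 ^+ (s - i) = GLval b 0 0 ^+ (r - i).
  apply: (mulIf (expf_neq0 i a_neq0)); rewrite -!exprD !subnK //.
  exact/esym/Fp_expr_modn.
rewrite [X in _ * X = _](coef_affine_borel Q b01 i_s).
rewrite [X in _ = _ * X](coef_affine_borel P b01 ir) Ea.
rewrite !mulr_sumr; apply: eq_bigr => j _.
have ji : (j <= i)%N by rewrite -ltnS.
have jm := leq_trans ji im.
have Crj : 'C(r, j)%:R != 0 :> 'F_p.
  by rewrite Fp_natr_neq0 // (bin_ndvd_le _ mp).
apply: (mulfI Crj); set M := _ * _ ^+ j.
have binR n : (i <= n)%N ->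
    'C(n, j)%:R * 'C(n - j, i - j)%:R = 'C(n, i)%:R * 'C(i, j)%:R :> 'F_p.
  by move=> i_n; rewrite -!natrM bin_mul_bin.
have := PQ j jm; have := binR r ir; have := binR s i_s.
rewrite -![M *+ _]mulr_natr.
move: ('C(r, j)%:R) ('C(s, j)%:R) ('C(r, i)%:R) ('C(s, i)%:R) ('C(i, j)%:R)
  ('C(r - j, i - j)%:R) ('C(s - j, i - j)%:R) => rj sj ri si ij rji sji Es Er E.
transitivity (ri * (rj * (affine Q)`_j) * M * sji); first by ring.
rewrite E; transitivity (ri * (sj * sji) * (affine P)`_j * M); first by ring.
rewrite Es; transitivity (si * (ri * ij) * (affine P)`_j * M); first by ring.
by rewrite -Er; ring.
Qed.

Lemma theta_multiple_transfer m p r s (p_pr : prime p) (P : sym_rep p r)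
    (Q : sym_rep p s) :
    (m < p)%N -> ~~ (p %| 'C(r, m))%N ->
    (forall g : {'GL_2['F_p]}, jets_match m (rep_act g P) (rep_act g Q)) ->
  P \in theta_subrep p_pr r (m + 1) -> Q \in theta_subrep p_pr s (m + 1).
Proof.
move=> mp r_ndvd PQ /theta_multiple_jet P0; apply/theta_multiple_jet => g i.
rewrite addn1 ltnS => im.
have bin_neq0 : 'C(r, i)%:R != 0 :> 'F_p.
  by rewrite Fp_natr_neq0 // (bin_ndvd_le _ mp).
apply: (mulfI bin_neq0); rewrite mulr0.
apply: etrans (PQ g i im) _.
by rewrite [X in _ * X]P0 ?mulr0 // addn1.
Qed.

(** * Prescribing the jets at all points *)

(** For m+1 < p this is clear from m+1 <= p-1. In the remaining case m+1 = p,
    the power is 1 - t^(p(p-1)) by Frobenius. *)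
Lemma Xn_dvd_expr_sub1 p m : prime p -> (m < p)%N ->
  'X^(m.+1) %| (1 - 'X^(p - 1) : {poly 'F_p}) ^+ m.+1 - 1.
Proof.
move=> p_pr mp; have [lt_mp|] := ltnP m (p - 1).
  rewrite subrX1 addrAC subrr add0r mulNr dvdpNr dvdp_mulr //.
  exact: dvdp_exp2l.
move=> le_pm; have -> : m.+1 = p by have := prime_gt0 p_pr; lia.
have pchar_poly : p \in [pchar {poly 'F_p}] by rewrite pchar_lalg pchar_Fp.
rewrite -(pFrobenius_autE pchar_poly (1 - _)) rmorphB rmorph1 /=.
rewrite addrAC subrr add0r pFrobenius_autE -exprM dvdpNr dvdp_exp2l //.
by rewrite leq_pmull // subn_gt0 prime_gt1.
Qed.

Lemma dehomog_tau_subst (F : fieldType) (lq : 2.-tuple {mpoly F[2]}) n k :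
  dehomog (('X_(0 : 'I_2) ^+ n - 'X_(0 : 'I_2) * 'X_(1 : 'I_2) ^+ k) \mPo lq) =
  dehomog (tnth lq 0) ^+ n - dehomog (tnth lq 0) * dehomog (tnth lq 1) ^+ k.
Proof.
by rewrite !(rmorphB, rmorphM, rmorphXn) /= !comp_mpolyXU -!tnth_nth.
Qed.

(** The form tau = X^p - X Y^(p-1) is theta / Y, so it vanishes at every point
    other than Y = 0. Hence tau^(m+1) kills the m-jets at the other points,
    while at Y = 0 it is 1 to order m by [Xn_dvd_expr_sub1]; a multiple of it
    of degree s can thus have any m-jet at Y = 0. The bound on s is what makes
    a cofactor of degree s - p(m+1) able to carry m+1 coefficients. *)
Lemma interpolation_block p m s (u : 'rV['F_p]_m.+1) :
    prime p -> (m < p)%N -> ((m + 1) * (p + 1) - 1 <= s)%N ->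
  exists Z : sym_rep p s, poly_rV (affine Z) = u /\
    forall g : {'GL_2['F_p]}, GLval g 0 1 != 0 ->
      poly_rV (affine (rep_act g Z)) = 0 :> 'rV_m.+1.
Proof.
move=> p_pr mp ms; pose q := rVpoly u.
have p_gt0 := prime_gt0 p_pr.
pose X : {mpoly 'F_p[2]} := 'X_(0 : 'I_2).
pose Y : {mpoly 'F_p[2]} := 'X_(1 : 'I_2).
pose tau := X ^+ p - X * Y ^+ (p - 1).
pose n := (s - p * m.+1)%N.
have ns : (p * m.+1 + n = s)%N by rewrite /n; nia.
have mn : (m <= n)%N by rewrite /n; nia.
have tau_homog : tau \is p.-homog.
  rewrite rpredB ?homog_varX //.
  have := dhomogM (homog_varX 'F_p 0 1) (homog_varX 'F_p 1 (p - 1)).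
  by rewrite subnKC.
have Z_homog : tau ^+ m.+1 * homogenize n q \is s.-homog.
  by rewrite -ns; apply: dhomogM (dhomogMn _ tau_homog) (homogenize_homog _ _).
exists (DHomog Z_homog); split=> [|g g01].
  apply/rowP => i; rewrite mxE.
  rewrite /affine rmorphM rmorphXn /= rmorphB !rmorphM !rmorphXn /=.
  rewrite dehomogX dehomogY expr1n mul1r homogenizeK; last first.
    exact: leq_trans (size_poly _ _) _.
  have /dvdpP[w wE] := Xn_dvd_expr_sub1 p_pr mp.
  rewrite -[_ ^+ m.+1](subrK 1) wE mulrDl mul1r coefD -mulrA mulrCA coefXnM.
  by rewrite ltn_ord add0r coef_rVpoly_ord.
(* As b != 0, tau takes at the first row (a, b) of g the value
   a^p - a b^(p-1) = 0, so t divides (g.tau)(1, t). *)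
apply/rowP => i; rewrite !mxE.
rewrite /affine /= rmorphM rmorphXn /= rmorphM rmorphXn /=.
suff /dvdpP[w wE] : 'X %| dehomog (tau \mPo GL2_subst g).
  rewrite [X in X ^+ m.+1 * _]wE exprMn mulrAC mulrC coefXnM.
  by rewrite ltn_ord.
rewrite -[X in X %| _]subr0 -polyC0 dvdp_XsubCl /root.
rewrite /tau /X /Y dehomog_tau_subst !dehomog_GL2_subst.
rewrite !(horner_exp, hornerE) /=.
by rewrite (Fp_expr_pred p_pr g01) Fp_expp // mulr1 subrr.
Qed.

HB.instance Definition _ (G : groupType) (F : fieldType)
    (V : representation G F) (g : G) :=
  GRing.isLinear.Build F V V _ (@rep_act _ _ V g) (@rep_act_linear _ _ V g).

(** This is the surjectivity of W onto a representation induced from B, when W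
    contains, for each value u of J, an element supported at the trivial
    coset. The translates of these elements by the inverses of the d i are
    supported at distinct cosets, so their sum has the required values. *)
Lemma prescribed_at_representatives (G : groupType) (F : fieldType)
    (W : representation G F) (U : lmodType F) (J : {linear W -> U})
    (B : G -> Prop) (I : finType) (A : {pred I}) (d : I -> G) :
    (forall u, exists z : W,
       J z = u /\ forall g, ~ B g -> J (rep_act g z) = 0) ->
    {in A &, forall i j, i != j -> ~ B (d i * (d j)^-1)%g} ->
  forall u : I -> U, exists w : W, {in A, forall i, J (rep_act (d i) w) = u i}.
Proof.
move=> /choice[z zP] d_sep u.
exists (\sum_(j in A) rep_act (d j)^-1%g (z (u j))) => i Ai.
rewrite !linear_sum (bigD1 i) //= big1 ?addr0 => [|j /andP[Aj ji]].
  by rewrite -rep_actM mulgV rep_act1 (zP _).1.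
by rewrite -rep_actM (zP _).2 //; apply: d_sep; rewrite // eq_sym.
Qed.

(** The stabilizer of the line spanned by Y, since g maps Y to bX + dY. *)
Definition borel p : {set {'GL_2['F_p]}} :=
  [set g : {'GL_2['F_p]} | GLval g 0 1 == 0].

Lemma borel_group_set p : group_set (borel p).
Proof.
apply/group_setP; split=> [|g h]; first by rewrite inE GL_1E mxE.
rewrite !inE => /eqP g01 /eqP h01.
rewrite GL_MxE mxE big_ord_recl big_ord1.
have -> : lift ord0 ord0 = 1 :> 'I_2 by apply: val_inj.
by rewrite h01 mulr0 add0r [GLval g _ _]g01 mul0r.
Qed.

Canonical borel_group p := Group (borel_group_set p).

Lemma mem_borelE p (g : {'GL_2['F_p]}) : (g \in borel p) = (GLval g 0 1 == 0).
Proof. by rewrite inE. Qed.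

Lemma borel_representatives p :
  exists (I : finType) (A : {pred I}) (d : I -> {'GL_2['F_p]}),
  {in A &, forall i j, i != j -> ~ GLval (d i * (d j)^-1)%g 0 1 = 0} /\
  forall g : {'GL_2['F_p]}, exists2 i, i \in A & GLval (g * (d i)^-1)%g 0 1 = 0.
Proof.
exists {set {'GL_2['F_p]}}, (fun C => C \in rcosets (borel p) setT), repr.
split.
  move=> _ _ /rcosetsP[x _ ->] /rcosetsP[y _ ->] neq /eqP.
  rewrite -mem_borelE -mem_rcoset => /rcoset_eqP; rewrite !rcoset_repr => E.
  by case/eqP: neq.
move=> g; exists (borel p :* g)%g.
  by rewrite mem_rcosets mulSGid ?subsetT // inE.
have : g \in (borel p :* repr (borel p :* g))%g.
  by rewrite rcoset_repr rcoset_refl.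
by rewrite mem_rcoset mem_borelE => /eqP.
Qed.

Lemma leq_quot_bound p m : (m <= (m + 1) * (p + 1) - 1)%N.
Proof. nia. Qed.

(** Q is obtained by prescribing its jets at the coset representatives, that
    is, once for each point; [jets_match_borel] extends the condition to all
    other g. *)
Lemma jets_match_total p m r s (P : sym_rep p r) :
    prime p -> (m < p)%N ->
    ((m + 1) * (p + 1) - 1 <= r)%N -> ((m + 1) * (p + 1) - 1 <= s)%N ->
    r = s %[mod p - 1] -> ~~ (p %| 'C(r, m))%N ->
  exists Q : sym_rep p s,
    forall g : {'GL_2['F_p]}, jets_match m (rep_act g P) (rep_act g Q).
Proof.
move=> p_pr mp mr ms rs r_ndvd.
have [mr' ms'] := (leq_trans (leq_quot_bound p m) mr,
                   leq_trans (leq_quot_bound p m) ms).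
have [I [A [d [d_sep d_cover]]]] := borel_representatives p.
pose u i : 'rV_m.+1 :=
  \row_j ('C(s, j)%:R / 'C(r, j)%:R * (affine (rep_act (d i) P))`_j).
have block v := interpolation_block v p_pr mp ms.
have [|Q QP] := @prescribed_at_representatives _ _ (sym_rep p s) _
    (@poly_rV _ m.+1 \o @affine p s) (fun g => GLval g 0 1 = 0) I A d _ d_sep u.
  move=> v; have [Z [Zv Z0]] := block v.
  by exists Z; split=> // g /eqP; apply: Z0.
exists Q => g; have [i Ai gi] := d_cover g.
have match_d : jets_match m (rep_act (d i) P) (rep_act (d i) Q).
  move=> j jm; have /rowP/(_ (Ordinal (jm : (j < m.+1)%N))) := QP i Ai.
  rewrite !mxE /= => jet_Q; rewrite [X in _ * X = _]jet_Q.
  rewrite mulrA mulrCA mulrV ?mulr1 //.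
  by rewrite unitfE Fp_natr_neq0 // (bin_ndvd_le _ mp).
have actE n (V : sym_rep p n) :
    rep_act (g * (d i)^-1)%g (rep_act (d i) V) = rep_act g V.
  by rewrite -rep_actM mulgKV.
rewrite -(actE r P) -(actE s Q).
exact: jets_match_borel match_d.
Qed.

(** * The isomorphism *)

Theorem corollary1p2 (p m r s : nat) (p_pr : prime p) :
  (m <= p - 1)%N ->
  ((m + 1) * (p + 1) - 1 <= r)%N ->
  ((m + 1) * (p + 1) - 1 <= s)%N ->
  (r = s %[mod p - 1])%N ->
  ~~ (p %| 'C(r, m))%N ->
  ~~ (p %| 'C(s, m))%N ->
  rep_isomorphic (quot_rep (theta_subrep p_pr r (m + 1)))
                 (quot_rep (theta_subrep p_pr s (m + 1))).
Proof.
move=> m_le r_ge s_ge rs r_ndvd s_ndvd.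
have mp : (m < p)%N.
  by rewrite (leq_ltn_trans m_le) // subn1 prednK ?prime_gt0.
pose R (P : sym_rep p r) (Q : sym_rep p s) :=
  forall g : {'GL_2['F_p]}, jets_match m (rep_act g P) (rep_act g Q).
apply: (quot_rep_isomorphic_of_correspondence (R := R)).
- move=> a P1 Q1 P2 Q2 R1 R2 g.
  rewrite (rep_act_linear g a P1 P2) (rep_act_linear g a Q1 Q2).
  exact: jets_match_linear.
- by move=> g P Q RPQ h; rewrite -!rep_actM.
- move=> P Q RPQ; split; first exact: (theta_multiple_transfer mp r_ndvd RPQ).
  exact: (theta_multiple_transfer mp s_ndvd (fun g => jets_match_sym (RPQ g))).
- by move=> P; apply: jets_match_total.
move=> Q; have [P QP] := jets_match_total Q p_pr mp s_ge r_ge (esym rs) s_ndvd.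
by exists P => g; apply: jets_match_sym.
Qed.
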